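(* Let $\varepsilon>0$ be fixed. There is $p_0(\varepsilon)$ such that the following holds for every prime $p>p_0(\varepsilon)$. Let $\mathcal{I}$ and $\mathcal{J}$ be nonzero intervals of $\mathbb{F}_p$ such that $$|\mathcal{I}|^2\cdot|\mathcal{J}|>p^{1+\varepsilon},\qquad |\mathcal{I}|\cdot|\mathcal{J}|^2>p^{1+\varepsilon}.$$ Then for every $\lambda\in\mathbb{F}_p$ the equation $$\sum_{i=1}^{8}\frac{x_i}{y_i}=\lambda$$ has a solution with $(x_1,\dots,x_8)\in\mathcal{I}^8$ and $(y_1,\dots,y_8)\in\mathcal{J}^8$ (with all $y_i\neq 0$).
   Context: $\mathbb{F}_p$ is the field of residues modulo the prime $p$. An interval of $\mathbb{F}_p$ is a set of the form $\{a,a+1,\dots,a+N-1\}$ (residues mod $p$) for some $a\in\mathbb{F}_p$ and integer $1\le N\le p$; it is called nonzero if it is not equal to $\{0\}$. $|\mathcal{X}|$ denotes cardinality. The fraction $x/y$ means $x\cdot y^{-1}$ in $\mathbb{F}_p$, so only $y\neq 0$ is allowed. Here $\varepsilon$ is a small fixed positive constant and $p$ is sufficiently large in terms of $\varepsilon$. *)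

(* Defs.v *)
From mathcomp Require Import all_boot all_order all_algebra.
From mathcomp Require Import reals exp.

Set Implicit Arguments.
Unset Strict Implicit.
Unset Printing Implicit Defensive.

Import GRing.Theory.
Local Open Scope ring_scope.

Definition Fp_interval (p : nat) (A : {set 'F_p}) : Prop :=
  exists (a : 'F_p) (N : nat),
    (1 <= N <= p)%N /\ A = [set a + (val k)%:R | k : 'I_N].

Definition nonzero_Fp_interval (p : nat) (A : {set 'F_p}) : Prop :=
  Fp_interval A /\ A <> [set 0].

(* Main.v *)
Require Import Defs.
From mathcomp Require Import all_boot all_order all_algebra all_field.
From mathcomp Require Import reals exp unstable.
From mathcomp Require Import zify ring.

Set Implicit Arguments.
Unset Strict Implicit.
Unset Printing Implicit Defensive.

Import Order.TTheory GRing.Theory Num.Theory.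
Local Open Scope ring_scope.

(** Write X = |I| and Y = |J|. The factor p^eps is only used to absorb an
    absolute constant C, through C p < X^2 Y and C p < X Y^2.

    If X^8 >= C p, eight fixed denominators suffice. Dirichlet's theorem applied
    to the centre b of J gives h b = +-u with h and u small. For a suitable G
    prime to h, the multiples of G among the integers u + h t with b +- t in J
    are G times the terms z of an arithmetic progression of difference h, with
    c min(X, Y) <= z <= X / 18; hence J contains +-(G / h) z for these z. Eight
    of them are pairwise coprime, and by the Chinese remainder theorem the
    integers sum_i s_i Z / z_i, where Z is the product of the z_i and
    0 <= s_i < X, fill an interval of length p.

    Otherwise Y^4 > C p^3 and one fixed numerator suffices. For a != 0 the sum
    S(a) = sum_(j, d < n) psi (a / (b + j + d)) satisfies, by Cauchy-Schwarz in
    j, |S(a)|^2 <= n sum_(d, e) |G (a / (e - d))|, where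
    G(t) = sum_x psi (t (1/x - 1/(x+1))) has mean square at most 6 p. Hence
    |S(a)|^4 <= 6 n^5 p^2, and the circle method applies. *)

(** * Coprime terms of arithmetic progressions *)

Lemma leq_double_divn (d n : nat) : (0 < d <= n)%N -> (n <= 2 * d * (n %/ d))%N.
Proof.
move=> /andP[d_gt0 d_le]; rewrite (leq_trans (ltnW (ltn_ceil n d_gt0))) //.
rewrite mulnC -mulnA mulnCA leq_mul2l mul2n -addnn -addn1 leq_add2l.
by rewrite divn_gt0 // d_le orbT.
Qed.

Lemma exists_modn_mul (a z n : nat) : (0 < z)%N -> coprime z a ->
  exists2 s : nat, (s < z)%N & (s * a = n %[mod z])%N.
Proof.
move=> z_gt0 cza; exists ((chinese z a n 0 %/ a) %% z)%N.
  by rewrite ltn_mod.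
have a_dvd : (a %| chinese z a n 0)%N.
  by apply/eqP; rewrite chinese_modr // mod0n.
by rewrite modnMml divnK // chinese_modl.
Qed.

Lemma exists_dvdn_term (G h u B : nat) : (0 < G)%N -> coprime G h ->
  exists2 t : nat, (B <= t < B + G)%N & (G %| u + h * t)%N.
Proof.
move=> G_gt0 cGh.
have [s s_lt sE] := exists_modn_mul (G.-1 * (u + h * B)) G_gt0 cGh.
exists (B + s)%N; first by rewrite leq_addr ltn_add2l.
rewrite mulnDr addnA [(h * s)%N]mulnC /dvdn -modnDmr sE modnDmr.
by rewrite -mulSn prednK // modnMr.
Qed.

Lemma exists_coprime_in_interval (h A : nat) : (0 < h)%N ->
  exists2 G : nat, (A < G <= A + h)%N & coprime G h.
Proof.
move=> h_gt0; exists ((A + h.-1) %/ h * h + 1)%N.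
  have := divn_eq (A + h.-1) h; have := ltn_pmod (A + h.-1) h_gt0.
  by move: ((A + h.-1) %/ h * h)%N => q; lia.
by rewrite coprime_sym /coprime gcdnMDl -/(coprime h 1) coprimen1.
Qed.

Lemma coprime_no_common_prime (a b : nat) : (0 < a)%N ->
  (forall q, prime q -> q %| a -> ~~ (q %| b))%N -> coprime a b.
Proof.
move=> a_gt0 no_common; rewrite /coprime eqn_leq gcdn_gt0 a_gt0 andbT leqNgt.
apply/negP => /pdivP[q q_pr]; rewrite dvdn_gcd => /andP[q_a].
exact/negP/no_common.
Qed.

Lemma exists_coprime_term (W z h : nat) : (0 < W)%N -> (0 < z)%N ->
  coprime z h -> exists2 s : nat, (s <= W)%N & coprime (z + h * s) W.
Proof.
(* A prime factor of W divides the witness iff it does not divide z. *)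
move=> W_gt0 z_gt0 czh; exists (W`_(\pi(z)^'))%N.
  exact: dvdn_leq (dvdn_part _ _).
rewrite coprime_sym; apply: coprime_no_common_prime => // q q_pr q_W.
have := pi_of_part (\pi(z)^') W_gt0 q.
rewrite !inE !mem_primes q_pr W_gt0 z_gt0 q_W part_gt0 /=.
case: (boolP (q %| z)%N) => [q_z /negbT q_s | q_z q_s].
  rewrite dvdn_addr // Euclid_dvdM // (negPf q_s) orbF -prime_coprime //.
  exact: coprime_dvdl czh.
by rewrite dvdn_addl // dvdn_mull.
Qed.

Definition coprime_family (I : eqType) (w : I -> nat) : Prop :=
  forall i j, i != j -> coprime (w i) (w j).

Lemma exists_pairwise_coprime_terms (m z h : nat) :
  (0 < z)%N -> coprime z h ->
  exists2 r : 'I_m.+1 -> nat, (forall i, (r i <= m.+1`!)%N) &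
    coprime_family (fun i => z + h * r i)%N.
Proof.
move=> z_gt0 czh.
have [s s_le czW] := exists_coprime_term (fact_gt0 m) z_gt0 czh.
exists (fun i : 'I_m.+1 => s + m`! * i)%N => [i | i j].
  by rewrite factS mulSn leq_add // mulnC leq_mul2r -ltnS ltn_ord orbT.
wlog lt_ij : i j / (i < j)%N => [ltW | _].
  case: (ltngtP i j) => [|lt_ji|/val_inj ->]; [exact: ltW | | by rewrite eqxx].
  by rewrite eq_sym coprime_sym; apply: ltW.
set zi := (z + h * (s + m`! * i))%N.
have ziE : zi = (h * m`! * i + (z + h * s))%N by rewrite /zi; ring.
have -> : (z + h * (s + m`! * j) = h * (m`! * (j - i)) + zi)%N.
  by rewrite /zi addnCA -mulnDr addnCA -mulnDr subnK // ltnW.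
have ci_h : coprime zi h.
  by rewrite coprime_sym /coprime /zi addnC mulnC gcdnMDl gcdnC.
have ci_W : coprime zi m`!.
  by rewrite coprime_sym /coprime ziE mulnAC gcdnMDl gcdnC.
have ci_diff : coprime zi (j - i).
  apply: coprime_dvdr ci_W; apply: dvdn_fact.
  by rewrite subn_gt0 lt_ij (leq_trans (leq_subr _ _)) // -ltnS.
by rewrite /coprime gcdnDr -/(coprime zi _) !coprimeMr ci_h ci_W.
Qed.

Lemma dilated_term_bounds (k h X Y N G w : nat) :
  (0 < k)%N -> (0 < h)%N -> (0 < N)%N ->
  (k * N < G * X <= k * N + h * X)%N -> (w * G <= N <= 2 * (w * G))%N ->
  (h * Y <= N)%N ->
  (k * w < X)%N /\ (minn X Y <= 4 * k * w)%N.
Proof.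
move=> k_gt0 h_gt0 N_gt0 /andP[GX_gt GX_le] /andP[wG_le N_le] hY_le.
have G_gt0 : (0 < G)%N by case: (G) GX_gt.
have kw_lt : (k * w < X)%N.
  rewrite -(ltn_pmul2r G_gt0) [(X * G)%N]mulnC -mulnA.
  by apply: leq_ltn_trans GX_gt; rewrite leq_mul2l wG_le orbT.
split=> //; case: (leqP (h * X) (k * N)) => [hX_le | hX_gt].
  rewrite geq_min; apply/orP; left; rewrite -(leq_pmul2r N_gt0).
  apply: (@leq_trans (X * (2 * (w * G)))); first by rewrite leq_mul2l N_le orbT.
  have GX_le_2kN : (G * X <= 2 * (k * N))%N by lia.
  have : (w * (G * X) <= w * (2 * (k * N)))%N.
    by rewrite leq_mul2l GX_le_2kN orbT.
  by lia.
have G_le : (G <= 2 * h)%N.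
  by rewrite -(leq_pmul2r (leq_ltn_trans (leq0n _) kw_lt)); lia.
have wG_le_wh : (w * G <= w * (2 * h))%N by rewrite leq_mul2l G_le orbT.
rewrite geq_min; apply/orP; right; apply: (@leq_trans (4 * w)); last by nia.
by rewrite -(leq_pmul2r h_gt0); lia.
Qed.

Lemma exists_dilation_factor (k c h u X Y : nat) :
  (0 < k)%N -> (0 < c)%N -> (0 < h)%N ->
  (12 * k * c * h <= X)%N -> (12 * c * h <= Y)%N ->
  (12 * k * c * u <= X * Y)%N ->
  exists G : nat,
    [/\ coprime G h, (0 < G)%N, (4 * c * G <= Y)%N
      & (k * (u + h * Y) < G * X <= k * (u + h * Y) + h * X)%N].
Proof.
move=> k_gt0 c_gt0 h_gt0 h_le_X h_le_Y u_le; set N := (u + h * Y)%N.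
have X_gt0 : (0 < X)%N.
  by apply: leq_trans h_le_X; rewrite !muln_gt0 k_gt0 c_gt0.
have [G /andP[G_gt G_le] cGh] := exists_coprime_in_interval (k * N %/ X) h_gt0.
have GX_le : (G * X <= k * N + h * X)%N.
  apply: (@leq_trans ((k * N %/ X + h) * X)).
    by rewrite leq_mul2r G_le orbT.
  by rewrite mulnDl leq_add2r leq_divM.
exists G; split=> //; first exact: leq_ltn_trans G_gt; last first.
  by rewrite -ltn_divLR // G_gt.
(* 4 c G X <= 4 c (k u + k h Y + h X), where each term is at most X Y / 3. *)
rewrite -(leq_pmul2r X_gt0).
have : (c * (G * X) <= c * (k * N + h * X))%N by rewrite leq_mul2l GX_le orbT.
have : (12 * k * c * h * Y <= X * Y)%N by rewrite leq_mul2r h_le_X orbT.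
have : (12 * c * h * X <= Y * X)%N by rewrite leq_mul2r h_le_Y orbT.
by rewrite /N; lia.
Qed.

Lemma exists_dilated_progression (k c h u X Y : nat) :
  (0 < k)%N -> (0 < c)%N -> (0 < h)%N -> coprime u h ->
  (12 * k * c * h <= X)%N -> (12 * c * h <= Y)%N ->
  (12 * k * c * u <= X * Y)%N ->
  exists G t z : nat,
    [/\ (0 < G <= Y)%N, (t + G * c <= Y)%N, (u + h * t = G * z)%N, coprime z h
      & forall s, (s <= c)%N ->
          (k * (z + h * s) < X)%N /\ (minn X Y <= 4 * k * (z + h * s))%N].
Proof.
move=> k_gt0 c_gt0 h_gt0 cuh h_le_X h_le_Y u_le.
have [G [cGh G_gt0 cG_le GX_bounds]] :=
  exists_dilation_factor k_gt0 c_gt0 h_gt0 h_le_X h_le_Y u_le.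
have G_le_Gc : (G <= G * c)%N by rewrite leq_pmulr.
have Y_half : (Y <= 2 * uphalf Y <= Y.+1)%N.
  by have := odd_double_half Y; rewrite uphalf_half; lia.
have [t t_bounds /dvdnP[z zE]] := exists_dvdn_term u (uphalf Y) G_gt0 cGh.
have t_le : (t + G * c <= Y)%N by lia.
have G_le : (G <= Y)%N.
  by rewrite (leq_trans G_le_Gc) // (leq_trans (leq_addl t _)).
exists G, t, z; split; rewrite ?G_gt0 //; first by rewrite zE mulnC.
  have : coprime (u + h * t) h.
    by rewrite coprime_sym /coprime addnC mulnC gcdnMDl gcdnC.
  by rewrite zE coprimeMl => /andP[].
move=> s s_le; have wG : ((z + h * s) * G = u + h * (t + G * s))%N.
  by rewrite mulnDl -zE; ring.
have tGs_le : (t + G * s <= Y)%N.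
  by rewrite (leq_trans _ t_le) // leq_add2l leq_mul2l s_le orbT.
have Y_le : (Y <= 2 * (t + G * s))%N by lia.
apply: (dilated_term_bounds k_gt0 h_gt0 _ GX_bounds); last exact: leq_addl.
  by rewrite addn_gt0 muln_gt0 h_gt0 (leq_trans G_gt0 G_le) orbT.
have : (h * (t + G * s) <= h * Y)%N by rewrite leq_mul2l tGs_le orbT.
have : (h * Y <= h * (2 * (t + G * s)))%N by rewrite leq_mul2l Y_le orbT.
by rewrite wG; lia.
Qed.

(** * Segments of residues *)

Section PrimeField.
Variables (p : nat) (p_pr : prime p).

Lemma natr_Fp_neq0 (n : nat) : (0 < n < p)%N -> n%:R != 0 :> 'F_p.
Proof.
by move=> /andP[n_gt0 n_lt]; rewrite -(dvdn_pcharf (pchar_Fp p_pr)) gtnNdvd.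
Qed.

Lemma ltn_Fp (x : 'F_p) : (x < p)%N.
Proof. by rewrite -[X in (_ < X)%N](Fp_cast p_pr) ltn_ord. Qed.

Lemma natr_ord_Fp_inj (n : nat) : (n <= p)%N ->
  injective (fun i : 'I_n => i%:R : 'F_p).
Proof.
move=> n_le i j /(congr1 val) /=.
rewrite !val_Fp_nat // !modn_small ?(leq_trans (ltn_ord _)) //.
exact: val_inj.
Qed.

Definition Fp_segment (a : 'F_p) (N : nat) : {set 'F_p} :=
  [set a + (val k)%:R | k : 'I_N].

Lemma mem_Fp_segment (a : 'F_p) (N k : nat) :
  (k < N)%N -> a + k%:R \in Fp_segment a N.
Proof. by move=> k_lt; apply/imsetP; exists (Ordinal k_lt). Qed.

Lemma card_Fp_segment (a : 'F_p) (N : nat) :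
  (N <= p)%N -> #|Fp_segment a N| = N.
Proof.
move=> N_le; rewrite card_imset ?card_ord // => i j /addrI.
exact: natr_ord_Fp_inj.
Qed.

Lemma mem_Fp_segment_centered (a : 'F_p) (N Y t : nat) (s : bool) :
  (Y + Y < N)%N -> (t <= Y)%N -> a + Y%:R + (-1) ^+ s * t%:R \in Fp_segment a N.
Proof.
move=> Y_lt t_le; case: s; rewrite /= ?expr1 ?mulN1r ?mul1r -addrA.
  by rewrite -natrB // mem_Fp_segment //; lia.
by rewrite -natrD mem_Fp_segment //; lia.
Qed.

Lemma Fp_segment_subset (b : 'F_p) (d N Y : nat) : (d + N <= Y)%N ->
  Fp_segment (b + d%:R) N \subset Fp_segment b Y.
Proof.
move=> dN_le; apply/subsetP => _ /imsetP[k _ ->]; rewrite -addrA -natrD.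
by apply: mem_Fp_segment; apply: leq_trans dN_le; rewrite ltn_add2l ltn_ord.
Qed.

Lemma exists_Fp_segment_avoiding0 (b : 'F_p) (N Y : nat) :
  (N + N <= Y <= p)%N ->
  exists2 b', Fp_segment b' N \subset Fp_segment b Y & 0 \notin Fp_segment b' N.
Proof.
move=> /andP[N_le Y_le].
have [/imsetP[k _ bk] | zero_notin] := boolP (0 \in Fp_segment b N); last first.
  exists b => //; have := @Fp_segment_subset b 0 N Y; rewrite addr0.
  by apply; lia.
exists (b + N%:R); first exact: Fp_segment_subset.
apply/imsetP => -[j _ bj].
have := ltn_ord k; have := ltn_ord j => j_lt k_lt.
have /natr_Fp_neq0/eqP[] : (0 < N + j - k < p)%N by lia.
rewrite natrB ?natrD; last by lia.
transitivity (b + N%:R + j%:R - (b + k%:R) : 'F_p); first by ring.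
by rewrite -bj -bk subrr.
Qed.

Lemma Fp_dirichlet (b : 'F_p) (H : nat) : (0 < H)%N ->
  exists (h u : nat) (s : bool),
    [/\ (0 < h <= H)%N, (u * H < p)%N & h%:R * b = (-1) ^+ s * u%:R].
Proof.
move=> H_gt0; have p_gt0 := prime_gt0 p_pr.
pose r (i : 'I_H.+1) : nat := (i%:R * b : 'F_p).
have rE i : (r i)%:R = i%:R * b :> 'F_p by rewrite natr_Zp.
have box_lt i : ((r i * H) %/ p < H)%N.
  by rewrite ltn_divLR // mulnC ltn_pmul2l // ltn_Fp.
pose box i : 'I_H := Ordinal (box_lt i).
have /injectivePn[i [j neq_ij /(congr1 val) /= eq_box]] : ~~ injectiveb box.
  by apply/negP => /injectiveP /leq_card; rewrite !card_ord ltnn.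
have same_box_close k l :
    ((r k * H) %/ p = (r l * H) %/ p -> (r k - r l) * H < p)%N.
  move=> eq_kl; have := ltn_ceil (r k * H) p_gt0; have := leq_divM (r l * H) p.
  by rewrite eq_kl mulnBl; nia.
wlog lt_ij : i j neq_ij eq_box / (i < j)%N => [ltW | ].
  case: (ltngtP i j) => [lt_ij | lt_ji | /val_inj eq_ij].
  - exact: (ltW i j).
  - by apply: (ltW j i) => //; rewrite eq_sym.
  - by rewrite eq_ij eqxx in neq_ij.
have diffE : (j - i)%:R * b = (r j)%:R - (r i)%:R :> 'F_p.
  by rewrite natrB ?(ltnW lt_ij) // mulrBl !rE.
have diff_le : (0 < j - i <= H)%N.
  by rewrite subn_gt0 lt_ij (leq_trans (leq_subr _ _)) // -ltnS.
case: (leqP (r i) (r j)) => [le_r | /ltnW le_r].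
  exists (j - i)%N, (r j - r i)%N, false; split=> //.
    exact: same_box_close.
  by rewrite diffE natrB // mul1r.
exists (j - i)%N, (r i - r j)%N, true; split=> //.
  exact: same_box_close.
by rewrite diffE natrB // expr1 mulN1r opprB.
Qed.

Lemma Fp_dirichlet_coprime (b : 'F_p) (H : nat) : (0 < H < p)%N ->
  exists (h u : nat) (s : bool),
    [/\ (0 < h <= H)%N, coprime u h, (u * H < p)%N
      & h%:R * b = (-1) ^+ s * u%:R].
Proof.
move=> /andP[H_gt0 H_lt].
have [h [u [s [/andP[h_gt0 h_le] uH_lt hbE]]]] := Fp_dirichlet b H_gt0.
set g := gcdn u h.
have g_gt0 : (0 < g)%N by rewrite gcdn_gt0 h_gt0 orbT.
have g_h : (g %| h)%N := dvdn_gcdr u h.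
have g_u : (g %| u)%N := dvdn_gcdl u h.
have g_le : (g <= h)%N := dvdn_leq h_gt0 g_h.
exists (h %/ g)%N, (u %/ g)%N, s; split.
- by rewrite divn_gt0 // g_le (leq_trans (leq_div _ _)).
- by rewrite /coprime -(eqn_pmul2r g_gt0) muln_gcdl !divnK // mul1n.
- by apply: leq_ltn_trans uH_lt; rewrite leq_mul // leq_div.
have g_neq0 : g%:R != 0 :> 'F_p.
  apply: natr_Fp_neq0.
  by rewrite g_gt0 (leq_ltn_trans g_le) // (leq_ltn_trans h_le).
apply: (mulfI g_neq0); rewrite mulrA mulrCA -!natrM ![(g * _)%N]mulnC.
by rewrite !divnK.
Qed.

End PrimeField.

Definition fraction_sums_cover (F : finFieldType) (m : nat)
    (A B : {set F}) : Prop :=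
  forall l : F, exists x y : 'I_m -> F,
    [/\ forall i, x i \in A, forall i, y i \in B, forall i, y i <> 0
      & \sum_(i < m) x i / y i = l].

(** * Fixed denominators *)

Lemma chinese_sum_repr (I : finType) (w : I -> nat) (n : nat) :
  (forall i, 0 < w i)%N -> coprime_family w ->
  (#|I| * \prod_i w i <= n)%N ->
  exists (s : I -> nat) (q : nat), (forall i, s i < w i)%N /\
    n = (\sum_i s i * \prod_(j | j != i) w j + q * \prod_i w i)%N.
Proof.
move=> w_gt0 w_coprime n_ge; pose cofactor i := (\prod_(j | j != i) w j)%N.
have prodE i : (\prod_j w j = w i * cofactor i)%N by rewrite (bigD1 i).
have w_cofactor i : coprime (w i) (cofactor i).
  apply: (big_ind (coprime (w i))) => [|x y cx cy|j ji].
  - exact: coprimen1.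
  - by rewrite coprimeMr cx.
  - by apply: w_coprime; rewrite eq_sym.
have [s s_lt sE] := fin_all_exists2
  (fun i => exists_modn_mul n (w_gt0 i) (w_cofactor i)).
have sum_le : (\sum_i s i * cofactor i <= n)%N.
  apply: leq_trans n_ge; rewrite -sum_nat_const; apply: leq_sum => i _.
  by rewrite (prodE i) leq_mul2r (ltnW (s_lt i)) orbT.
have /dvdnP[q qE] : (\prod_i w i %| n - \sum_i s i * cofactor i)%N.
  apply/Gauss_dvd_prod => [|i _ _].
    rewrite pairwise_map filter_predT.
    have := index_enum_uniq I; rewrite uniq_pairwise.
    exact/sub_pairwise/w_coprime.
  have others_dvd : (w i %| \sum_(j | j != i) s j * cofactor j)%N.
    apply: dvdn_sum => j ji; apply: dvdn_mull.
    by rewrite /cofactor (bigD1 i) ?dvdn_mulr // eq_sym.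
  by rewrite -eqn_mod_dvd // (bigD1 i) //= -modnDmr (eqP others_dvd) addn0 sE.
by exists s, q; split=> //; rewrite -qE subnKC.
Qed.

Lemma chinese_fraction_repr (F : fieldType) (I : finType) (w : I -> nat)
    (n : nat) :
  (forall i, (w i)%:R != 0 :> F) -> coprime_family w ->
  (#|I| * \prod_i w i <= n)%N ->
  exists (s : I -> nat) (q : nat),
    [/\ forall i, (s i < w i)%N, (q * \prod_i w i <= n)%N
      & n%:R / (\prod_i w i)%:R = \sum_i (s i)%:R / (w i)%:R + q%:R :> F].
Proof.
move=> w_neq0 w_coprime n_ge.
have w_gt0 i : (0 < w i)%N by rewrite lt0n; apply: contraNneq (w_neq0 i) => ->.
have [s [q [s_lt nE]]] := chinese_sum_repr w_gt0 w_coprime n_ge.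
exists s, q; split=> //; first by rewrite nE leq_addl.
have prod_neq0 (P : pred I) : (\prod_(i | P i) w i)%:R != 0 :> F.
  by rewrite natr_prod; apply/prodf_neq0.
rewrite nE natrD natrM mulrDl mulfK // natr_sum mulr_suml; congr (_ + _).
apply: eq_bigr => i _; rewrite [X in _ / X%:R](bigD1 i) //= !natrM.
by field; rewrite w_neq0 prod_neq0.
Qed.

Lemma fraction_sum_coprime_denominators (p m H X : nat) (w : 'I_m.+1 -> nat) :
  prime p -> (0 < H)%N -> (2 * p <= H ^ m * X)%N ->
  (forall i, 0 < w i < p)%N -> coprime_family w ->
  (forall i, H <= w i)%N -> (forall i, 2 * m.+2 * w i <= X)%N ->
  forall mu : 'F_p, exists2 k : 'I_m.+1 -> nat, (forall i, k i < X)%N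
    & \sum_i (k i)%:R / (w i)%:R = mu.
Proof.
move=> p_pr H_gt0 Hm_ge w_bounds w_coprime w_ge w_le mu.
have w_neq0 i : (w i)%:R != 0 :> 'F_p by exact: natr_Fp_neq0.
pose M := (\prod_(i < m) w (lift ord0 i))%N; pose Z := (\prod_i w i)%N.
have ZE : Z = (w ord0 * M)%N by rewrite /Z big_ord_recl.
have M_ge : (H ^ m <= M)%N.
  by rewrite -[m in (H ^ m)%N]card_ord -prod_nat_const; apply: leq_prod.
have M_gt0 : (0 < M)%N by apply: leq_trans M_ge; rewrite expn_gt0 H_gt0.
have Z_neq0 : Z%:R != 0 :> 'F_p by rewrite natr_prod; apply/prodf_neq0.
pose gap : 'F_p := mu * Z%:R - (m.+1 * Z)%:R; pose n := (m.+1 * Z + gap)%N.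
have nE : n%:R = mu * Z%:R :> 'F_p by rewrite natrD natr_Zp addrC subrK.
have n_lt : (n < m.+1 * Z + p)%N by rewrite ltn_add2l ltn_Fp.
have [|s [q [s_lt q_le muE]]] :=
  chinese_fraction_repr (n := n) w_neq0 w_coprime.
  by rewrite card_ord leq_addr.
rewrite -/Z nE mulfK // in muE q_le.
(* The integer part q is absorbed by the first fraction, as q w_0 / w_0. *)
exists (fun i => if i == ord0 then s ord0 + q * w ord0 else s i)%N => [i|].
  case: eqP => [_ | _]; last by have := s_lt i; have := w_le i; nia.
  have qw_lt : (2 * (q * w ord0) < 2 * m.+1 * w ord0 + X)%N.
    rewrite -(ltn_pmul2r M_gt0).
    have : (H ^ m * X <= M * X)%N by rewrite leq_mul2r M_ge orbT.
    by have := leq_ltn_trans q_le n_lt; rewrite ZE; lia.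
  by have := s_lt ord0; have := w_le ord0; lia.
by rewrite muE !big_ord_recl /= addrAC natrD natrM mulrDl mulfK.
Qed.

Lemma coprime_denominators_near (p k m H X Y : nat) (b : 'F_p) :
  prime p -> (0 < k)%N -> (0 < H)%N -> (Y < p)%N ->
  (12 * k * m.+1`! * H <= X)%N -> (12 * k * m.+1`! * H <= Y)%N ->
  (12 * k * m.+1`! * p <= X * Y * H)%N ->
  exists (r : 'F_p) (w : 'I_m.+1 -> nat),
    [/\ r != 0, coprime_family w,
        forall i, (H <= w i)%N /\ (k * w i < X)%N
      & forall i, exists (s : bool) (t : nat),
          (t <= Y)%N /\ r * (w i)%:R = b + (-1) ^+ s * t%:R].
Proof.
set M := m.+1`! => p_pr k_gt0 H_gt0 Y_lt cH_le_X cH_le_Y cp_le.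
have M_gt0 : (0 < M)%N := fact_gt0 _.
have kM_gt0 : (0 < k * M)%N by rewrite muln_gt0 k_gt0.
have H_le_Y : (H <= Y)%N by nia.
have H_lt : (0 < H < p)%N by rewrite H_gt0 (leq_ltn_trans H_le_Y).
have [h [u [s [/andP[h_gt0 h_le] cuh uH_lt hbE]]]] :=
  Fp_dirichlet_coprime p_pr b H_lt.
have [|||G [t [z [/andP[G_gt0 G_le] tG_le GzE czh z_bounds]]]] :=
  exists_dilated_progression (X := X) (Y := Y) k_gt0 M_gt0 h_gt0 cuh.
- by apply: leq_trans cH_le_X; rewrite leq_mul2l h_le orbT.
- apply: leq_trans cH_le_Y; apply: leq_mul h_le.
  by rewrite leq_mul2r leq_pmulr ?orbT.
- rewrite -(leq_pmul2r H_gt0); apply: leq_trans cp_le.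
  by rewrite -mulnA leq_mul2l (ltnW uH_lt) orbT.
have kH_le : (4 * k * H <= minn X Y)%N by rewrite leq_min; nia.
have H_le_z s' : (s' <= M)%N -> (H <= z + h * s')%N.
  move=> /z_bounds[_ minXY_le]; rewrite -(@leq_pmul2l (4 * k)) ?muln_gt0 //.
  exact: leq_trans minXY_le.
have z_gt0 : (0 < z)%N.
  by have := H_le_z 0%N isT; rewrite muln0 addn0; apply: leq_trans.
have [r r_le w_coprime] := exists_pairwise_coprime_terms m z_gt0 czh.
have h_neq0 : h%:R != 0 :> 'F_p.
  apply: natr_Fp_neq0; rewrite // h_gt0 (leq_ltn_trans h_le) //.
  by case/andP: H_lt.
have G_neq0 : G%:R != 0 :> 'F_p.
  by apply: natr_Fp_neq0; rewrite // G_gt0 (leq_ltn_trans G_le).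
exists ((-1) ^+ s * G%:R / h%:R), (fun i => z + h * r i)%N; split=> [||i|i] //.
- by rewrite !mulf_neq0 ?invr_eq0 ?signr_eq0.
- by split; [exact: H_le_z | have [] := z_bounds _ (r_le i)].
exists s, (t + G * r i)%N; split.
  by apply: leq_trans tG_le; rewrite leq_add2l leq_mul2l r_le orbT.
have dilateE : (u + h * (t + G * r i) = G * (z + h * r i))%N.
  by rewrite mulnDr addnA GzE; ring.
apply: (mulfI h_neq0); rewrite [RHS]mulrDr hbE [X in _ + X]mulrCA -mulrDr.
by rewrite -natrM -natrD dilateE natrM; field.
Qed.

Lemma fraction_sums_cover_segments (p m H X Y N : nat) (a b : 'F_p) :
  let C := (24 * m.+2 * m.+1`!)%N in
  prime p -> (0 < H)%N -> (X <= p)%N -> (Y + Y < N <= p)%N ->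
  (C * H <= X)%N -> (C * H <= Y)%N -> (C * p <= X * Y * H)%N ->
  (2 * p <= H ^ m * X)%N ->
  fraction_sums_cover m.+1 (Fp_segment a X) (Fp_segment b N).
Proof.
move=> C p_pr H_gt0 X_le /andP[Y_lt N_le] CH_le_X CH_le_Y Cp_le Hm_ge l.
have CE : C = (12 * (2 * m.+2) * m.+1`!)%N by rewrite /C; ring.
rewrite CE in CH_le_X CH_le_Y Cp_le.
have [//||r [w [r_neq0 w_coprime w_bounds wE]]] :=
  coprime_denominators_near (b + Y%:R) p_pr _ H_gt0 _ CH_le_X CH_le_Y Cp_le.
  by lia.
have w_lt i : (0 < w i < p)%N by have [] := w_bounds i; nia.
have w_neq0 i : (w i)%:R != 0 :> 'F_p by exact: natr_Fp_neq0.
have [||k k_lt kE] :=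
  fraction_sum_coprime_denominators p_pr H_gt0 Hm_ge w_lt w_coprime _ _
    (r * l - a * \sum_i (w i)%:R^-1).
- by move=> i; have [] := w_bounds i.
- by move=> i; have [_ /ltnW] := w_bounds i.
exists (fun i => a + (k i)%:R), (fun i => r * (w i)%:R); split=> [i|i|i|].
- exact: mem_Fp_segment.
- by have [s [t [t_le ->]]] := wE i; apply: mem_Fp_segment_centered t_le.
- by apply/eqP; rewrite mulf_neq0.
apply: (mulfI r_neq0); rewrite -[RHS](subrK (a * \sum_i (w i)%:R^-1)) -kE.
rewrite !mulr_sumr -big_split; apply: eq_bigr => i _ /=.
by field; rewrite r_neq0 w_neq0.
Qed.

Lemma minn_large_products (m E K p X Y : nat) :
  (1 < m)%N -> (E ^ 2 <= K)%N -> (0 < p)%N -> (X <= p)%N -> (Y <= p)%N ->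
  (K * p <= X ^ 2 * Y)%N -> (K * p <= X * Y ^ 2)%N -> (K * p <= X ^ m.+1)%N ->
  [/\ (E <= minn X Y)%N, (K * p <= X * Y * minn X Y)%N
    & (K * p <= minn X Y ^ m * X)%N].
Proof.
move=> m_gt1 K_ge p_gt0 X_le Y_le KX2Y KXY2 KX.
have E_le_X : (E <= X)%N.
  rewrite -leq_sqr (leq_trans K_ge) // -(leq_pmul2r p_gt0).
  by rewrite (leq_trans KX2Y) // leq_mul2l Y_le orbT.
have E_le_Y : (E <= Y)%N.
  rewrite -leq_sqr (leq_trans K_ge) // -(leq_pmul2r p_gt0).
  by rewrite (leq_trans KXY2) // mulnC leq_mul2l X_le orbT.
case: (leqP X Y) => [_ | /ltnW Y_le_X]; split=> //.
- by rewrite mulnAC.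
- by rewrite -expnSr.
- by rewrite -mulnA.
apply: leq_trans KXY2 _; rewrite mulnC leq_mul2r; apply/orP; right.
case: Y {Y_le KX2Y E_le_Y Y_le_X} => [|Y]; last by rewrite leq_pexp2l.
by rewrite exp0n // (leq_trans _ m_gt1).
Qed.

Lemma exists_dirichlet_parameters (m C K p X Y : nat) :
  (1 < m)%N -> (0 < C)%N ->
  ((16 * C) ^ 2 <= K)%N -> (2 * (16 * C) ^ m <= K)%N ->
  (0 < p)%N -> (X <= p)%N -> (Y <= p)%N ->
  (K * p <= X ^ 2 * Y)%N -> (K * p <= X * Y ^ 2)%N -> (K * p <= X ^ m.+1)%N ->
  exists H Y' : nat,
    [/\ (0 < H)%N, (Y' + Y' < Y)%N, (C * H <= X)%N /\ (C * H <= Y')%N,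
        (C * p <= X * Y' * H)%N & (2 * p <= H ^ m * X)%N].
Proof.
move=> m_gt1 C_gt0 K_ge2 K_ge p_gt0 X_le Y_le KX2Y KXY2 KX.
have [A_ge KXYA KAX] :=
  minn_large_products m_gt1 K_ge2 p_gt0 X_le Y_le KX2Y KXY2 KX.
have [A_le_X A_le_Y] := (geq_minl X Y, geq_minr X Y).
move: (minn X Y) => A in A_ge KXYA KAX A_le_X A_le_Y.
have C8_bounds : (0 < 8 * C <= A)%N by clear -A_ge C_gt0; lia.
have Y_ge : (0 < 4 <= Y)%N by clear -A_ge A_le_Y C_gt0; lia.
pose H := (A %/ (8 * C))%N.
have H_gt0 : (0 < H)%N by rewrite divn_gt0; case/andP: C8_bounds.
have CH_le : (8 * (C * H) <= A)%N by rewrite mulnA mulnC leq_divM.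
have A_le : (A <= 16 * C * H)%N.
  by rewrite -[16%N]/(2 * 8)%N -(mulnA 2%N) leq_double_divn.
pose Y' := (Y %/ 4)%N.
have Y'_le : (Y' * 4 <= Y)%N := leq_divM _ _.
have Y_le_Y' : (Y <= 8 * Y')%N := @leq_double_divn 4 Y Y_ge.
exists H, Y'; split=> //; [clear -Y'_le Y_ge; lia | split | |].
- by clear -CH_le A_le_X; lia.
- by clear -CH_le A_le_Y Y_le_Y'; lia.
- rewrite -(@leq_pmul2l (8 * (16 * C))) ?muln_gt0 //.
  apply: (@leq_trans (K * p)).
    by rewrite mulnA leq_mul2r (leq_trans _ K_ge2) ?orbT //; clear; nia.
  apply: (leq_trans KXYA); apply: (@leq_trans (X * (8 * Y') * (16 * C * H))).
    by rewrite !leq_mul.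
  by clear; lia.
have pow_gt0 : (0 < (16 * C) ^ m)%N by rewrite expn_gt0 muln_gt0 C_gt0.
rewrite -(leq_pmul2l pow_gt0); apply: (@leq_trans (K * p)).
  by rewrite mulnA leq_mul2r mulnC K_ge orbT.
rewrite (leq_trans KAX) // mulnA -expnMn leq_mul2r leq_exp2r ?A_le ?orbT //.
exact: ltnW.
Qed.

Lemma fraction_sums_cover_large_numerators (m : nat) : (1 < m)%N ->
  exists K : nat, forall (p : nat) (a b : 'F_p) (X Y : nat),
    prime p -> (X <= p)%N -> (Y <= p)%N ->
    (K * p <= X ^ 2 * Y)%N -> (K * p <= X * Y ^ 2)%N -> (K * p <= X ^ m.+1)%N ->
    fraction_sums_cover m.+1 (Fp_segment a X) (Fp_segment b Y).
Proof.
move=> m_gt1; pose C := (24 * m.+2 * m.+1`!)%N.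
have C_gt0 : (0 < C)%N by rewrite muln_gt0 fact_gt0.
exists ((16 * C) ^ 2 + 2 * (16 * C) ^ m)%N.
move=> p a b X Y p_pr X_le Y_le KX2Y KXY2 KX.
have [H [Y' [H_gt0 Y'_lt [CH_le_X CH_le_Y'] Cp_le Hm_ge]]] :=
  exists_dirichlet_parameters m_gt1 C_gt0 (leq_addr _ _) (leq_addl _ _)
    (prime_gt0 p_pr) X_le Y_le KX2Y KXY2 KX.
by apply: fraction_sums_cover_segments H_gt0 X_le _ CH_le_X CH_le_Y' _ _;
  rewrite ?Y'_lt.
Qed.

(** * Exponential sums over reciprocals *)

Lemma ler_sum_inj (R : numDomainType) (T U : finType) (h : T -> U)
    (F : U -> R) :
  injective h -> (forall u, 0 <= F u) -> \sum_t F (h t) <= \sum_u F u.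
Proof.
move=> h_inj F_ge0.
have <- : \sum_(u in h @: T) F u = \sum_t F (h t).
  by rewrite big_imset //; apply: in2W.
by rewrite [leRHS](bigID (mem (h @: T))) /= lerDl sumr_ge0.
Qed.

Lemma sqr_norm_sum_le (C : numClosedFieldType) (T : finType) (c : T -> C) :
  `|\sum_t c t| ^+ 2 <= #|T|%:R * \sum_t `|c t| ^+ 2.
Proof.
pose u : 'rV[C]_#|T| := \row_i c (enum_val i).
have [+ _] := CauchySchwarz (@dotmx C #|T|) u (const_mx 1).
rewrite mulrC /= !dotmxE !mxE.
rewrite !(reindex _ (onW_bij _ (enum_val_bij T))) /=.
congr (`|_| ^+ 2 <= _ * _).
- by apply: eq_bigr => i _; rewrite !mxE conjC1 mulr1.
- under eq_bigr do rewrite !mxE conjC1 mulr1.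
  by rewrite sumr_const card_ord.
- by apply: eq_bigr => i _; rewrite !mxE normCK.
Qed.

Section AdditiveCharacter.
Variables (p : nat) (p_pr : prime p) (w : algC) (w_prim : p.-primitive_root w).

Definition psi (x : 'F_p) : algC := w ^+ (x : nat).

Lemma psi_nat (n : nat) : psi n%:R = w ^+ n.
Proof. by rewrite /psi val_Fp_nat // prim_expr_mod. Qed.

Lemma psi0 : psi 0 = 1. Proof. by []. Qed.

Lemma psiD (x y : 'F_p) : psi (x + y) = psi x * psi y.
Proof. by rewrite -{1}(natr_Zp x) -{1}(natr_Zp y) -natrD psi_nat exprD. Qed.

Lemma psi_sum (T : finType) (f : T -> 'F_p) :
  psi (\sum_t f t) = \prod_t psi (f t).
Proof. exact: (big_morph psi psiD psi0). Qed.

Lemma norm_psi (x : 'F_p) : `|psi x| = 1.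
Proof.
rewrite normrX; suff -> : `|w| = 1 by rewrite expr1n.
apply/eqP; rewrite -(@pexpr_eq1 _ _ p) ?prime_gt0 //.
by rewrite -normrX prim_expr_order // normr1.
Qed.

Lemma conj_psi (x : 'F_p) : (psi x)^* = psi (- x).
Proof.
have psi_neq0 : psi x != 0 by rewrite -normr_eq0 norm_psi oner_eq0.
apply: (mulfI psi_neq0); rewrite -normCK norm_psi expr1n.
by rewrite -psiD subrr psi0.
Qed.

Lemma psi_eq1 (x : 'F_p) : (psi x == 1) = (x == 0).
Proof.
by rewrite -(prim_order_dvd w_prim) (dvdn_pcharf (pchar_Fp p_pr)) natr_Zp.
Qed.

Lemma sum_psi (a : 'F_p) : \sum_(x : 'F_p) psi (x * a) = (p * (a == 0))%:R.
Proof.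
case: eqP => [->|/eqP a_neq0].
  under eq_bigr do rewrite mulr0 psi0.
  by rewrite sumr_const card_Fp // muln1.
rewrite muln0; set s := \sum_x _.
have sE : psi a * s = s.
  rewrite mulr_sumr [RHS](reindex_inj (addrI 1)); apply: eq_bigr => x _.
  by rewrite -psiD mulrDl mul1r.
apply/eqP; move/eqP: sE.
rewrite -subr_eq0 -{2}[s]mul1r -mulrBl mulf_eq0 subr_eq0.
by rewrite psi_eq1 (negPf a_neq0).
Qed.

Definition expsum (T : finType) (f : T -> 'F_p) (a : 'F_p) : algC :=
  \sum_t psi (a * f t).

Lemma expsum0 (T : finType) (f : T -> 'F_p) : expsum f 0 = #|T|%:R.
Proof.
rewrite /expsum; under eq_bigr do rewrite mul0r psi0.
by rewrite sumr_const.
Qed.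

Lemma norm_expsum_le (T : finType) (f : T -> 'F_p) (a : 'F_p) :
  `|expsum f a| <= #|T|%:R.
Proof.
apply: le_trans (ler_norm_sum _ _ _) _; rewrite -sumr_const.
by apply: ler_sum => t _; rewrite norm_psi.
Qed.

Lemma sqr_norm_expsum (T : finType) (f : T -> 'F_p) (a : 'F_p) :
  `|expsum f a| ^+ 2 = \sum_s \sum_t psi (a * (f s - f t)).
Proof.
rewrite normCK rmorph_sum mulr_suml; apply: eq_bigr => s _.
rewrite mulr_sumr; apply: eq_bigr => t _.
by rewrite /= conj_psi -psiD mulrBr.
Qed.

Lemma sum_sqr_norm_expsum (T : finType) (f : T -> 'F_p) :
  \sum_a `|expsum f a| ^+ 2 = (p * #|[set st : T * T | f st.1 == f st.2]|)%:R.
Proof.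
under eq_bigr do rewrite sqr_norm_expsum pair_bigA.
rewrite exchange_big /=.
rewrite (eq_bigr _ (fun st _ => sum_psi (f st.1 - f st.2))).
rewrite -natr_sum -big_distrr /=; congr (_ * _)%:R.
rewrite -sum1_card [RHS]big_mkcond /=; apply: eq_bigr => st _.
by rewrite inE subr_eq0; case: eqP.
Qed.

Lemma expsum_cover (m : nat) (T : finType) (f : T -> 'F_p) :
  \sum_(a | a != 0) `|expsum f a| ^+ m < #|T|%:R ^+ m ->
  forall l : 'F_p, exists t : 'I_m -> T, \sum_i f (t i) = l.
Proof.
move=> small l.
case: (boolP [exists g : {ffun 'I_m -> T}, \sum_i f (g i) == l]).
  by case/existsP=> g /eqP sum_gE; exists g.
rewrite negb_exists => /forallP not_repr; exfalso.
have : \sum_a psi (a * - l) * expsum f a ^+ m = 0.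
  transitivity
    (\sum_a \sum_(g : {ffun 'I_m -> T}) psi (a * (\sum_i f (g i) - l))).
    apply: eq_bigr => a _.
    rewrite -[m in _ ^+ m]card_ord -prodr_const bigA_distr_bigA mulr_sumr.
    apply: eq_bigr => g _; rewrite -psi_sum -psiD; congr psi.
    by rewrite mulrBr mulr_sumr mulrN addrC.
  rewrite exchange_big big1 //= => g _; rewrite sum_psi subr_eq0.
  by rewrite (negPf (not_repr g)) muln0.
rewrite (bigD1 0) //= mul0r psi0 mul1r expsum0 => /eqP.
rewrite addr_eq0 => /eqP main_termE.
have : `|#|T|%:R ^+ m| <= \sum_(a | a != 0) `|expsum f a| ^+ m.
  rewrite main_termE normrN; apply: le_trans (ler_norm_sum _ _ _) _.
  by apply: ler_sum => a _; rewrite normrM norm_psi mul1r normrX.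
by rewrite normrX normr_nat => /le_lt_trans/(_ small); rewrite ltxx.
Qed.

End AdditiveCharacter.

Definition invr_diff (F : fieldType) (t : F) : F := t^-1 - (t + 1)^-1.

Lemma invr_diff_eq (F : fieldType) (s t : F) : invr_diff s = invr_diff t ->
  [|| s == 0, s == -1, t == 0, t == -1, t == s | t == -1 - s].
Proof.
rewrite /invr_diff => eq_st.
have [// | s_neq0] := eqVneq s 0; have [// | s_neqN1] := eqVneq s (-1).
have [// | t_neq0] := eqVneq t 0; have [// | t_neqN1] := eqVneq t (-1).
have s1_neq0 : s + 1 != 0 by rewrite addr_eq0.
have t1_neq0 : t + 1 != 0 by rewrite addr_eq0.
have : (t - s) * (t - (-1 - s)) = 0.
  transitivity (s * (s + 1) * (t * (t + 1)) *
     ((s^-1 - (s + 1)^-1) - (t^-1 - (t + 1)^-1))).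
    by field; rewrite s_neq0 s1_neq0 t_neq0 t1_neq0.
  by rewrite eq_st subrr mulr0.
by move/eqP; rewrite mulf_eq0 !subr_eq0.
Qed.

Lemma card_invr_diff_eq (F : finFieldType) :
  (#|[set st : F * F | invr_diff st.1 == invr_diff st.2]| <= 6 * #|F|)%N.
Proof.
pose curves : seq (F * F) := [seq (0, x) | x : F] ++ [seq (-1, x) | x : F]
  ++ [seq (x, 0) | x : F] ++ [seq (x, -1) | x : F]
  ++ [seq (x, x) | x : F] ++ [seq (x, -1 - x) | x : F].
apply: (@leq_trans #|curves|); last first.
  apply: leq_trans (card_size _) _.
  by rewrite !size_cat !size_codom 5!mulSn mul1n.
apply/subset_leq_card/subsetP => -[s t]; rewrite inE /= => /eqP /invr_diff_eq.
rewrite !mem_cat.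
case/or4P => [/eqP-> | /eqP-> | /eqP-> | /or3P[] /eqP->].
- by rewrite (codom_f (fun x => (0, x))).
- by rewrite (codom_f (fun x => (-1, x))) ?orbT.
- by rewrite (codom_f (fun x => (x, 0))) ?orbT.
- by rewrite (codom_f (fun x => (x, -1))) ?orbT.
- by rewrite (codom_f (fun x => (x, x))) ?orbT.
- by rewrite (codom_f (fun x => (x, -1 - x))) ?orbT.
Qed.

Section ReciprocalSums.
Variables (p : nat) (p_pr : prime p) (w : algC) (w_prim : p.-primitive_root w).
Local Notation psi := (psi w).
Local Notation expsum_invr_diff := (expsum w (@invr_diff 'F_p)).

Lemma sum_psi_invr_diff (a d e : 'F_p) :
  \sum_y psi (a * ((y + d)^-1 - (y + e)^-1))
    = expsum_invr_diff (a / (e - d)).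
Proof.
have [-> | neq_ed] := eqVneq e d.
  rewrite subrr invr0 mulr0 expsum0 -sumr_const.
  by apply: eq_bigr => y _; rewrite subrr mulr0 psi0.
have ed_neq0 : e - d != 0 by rewrite subr_eq0.
rewrite (reindex_inj (addIr (- d))) (reindex_inj (mulfI ed_neq0)) /=.
apply: eq_bigr => t _; congr psi; rewrite subrK.
have -> : (e - d) * t - d + e = (e - d) * (t + 1) by ring.
by rewrite !invfM -mulrBr mulrA.
Qed.

Lemma sum_sqr_norm_expsum_invr_diff_le :
  \sum_a `|expsum_invr_diff a| ^+ 2 <= (6 * p ^ 2)%:R.
Proof.
have -> : (6 * p ^ 2 = p * (6 * #|'F_p|))%N by rewrite card_Fp //; ring.
by rewrite sum_sqr_norm_expsum // ler_nat leq_mul2l card_invr_diff_eq orbT.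
Qed.

Variable n : nat.
Hypothesis n_le : (n <= p)%N.

Definition shifted_reciprocal (b : 'F_p) (jd : 'I_n * 'I_n) : 'F_p :=
  (b + jd.1%:R + jd.2%:R)^-1.

Definition reciprocal_segment_sum (a y : 'F_p) : algC :=
  \sum_(d < n) psi (a * (y + d%:R)^-1).

Lemma sum_sqr_norm_reciprocal_segment_sum_le (a : 'F_p) : a != 0 ->
  (\sum_y `|reciprocal_segment_sum a y| ^+ 2) ^+ 2 <= (6 * n ^ 3 * p ^ 2)%:R.
Proof.
move=> a_neq0; pose G (de : 'I_n * 'I_n) : algC :=
  expsum_invr_diff (a / (de.2%:R - de.1%:R)).
set V := \sum_y _; have VE : V = \sum_de G de.
  transitivity (\sum_(y : 'F_p) \sum_(de : 'I_n * 'I_n)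
      psi (a * ((y + de.1%:R)^-1 - (y + de.2%:R)^-1))).
    apply: eq_bigr => y _.
    have := sqr_norm_expsum p_pr w_prim (fun d : 'I_n => (y + d%:R)^-1) a.
    by rewrite pair_bigA.
  by rewrite exchange_big; apply: eq_bigr => de _; rewrite sum_psi_invr_diff.
have sum_G_le : \sum_de `|G de| ^+ 2 <= (n * (6 * p ^ 2))%:R.
  rewrite -(pair_bigA _ (fun d e => `|G (d, e)| ^+ 2)) natrM mulr_natl.
  rewrite -[n in leRHS]card_ord -sumr_const; apply: ler_sum => d _.
  apply: le_trans sum_sqr_norm_expsum_invr_diff_le.
  apply: (ler_sum_inj (h := fun e : 'I_n => a / (e%:R - d%:R))
     (F := fun b => `|expsum_invr_diff b| ^+ 2)) => [e e'|b].
    by move=> /(mulfI a_neq0)/invr_inj/addIr; exact: natr_ord_Fp_inj.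
  by rewrite exprn_ge0.
have <- : `|V| = V.
  by rewrite ger0_norm // sumr_ge0 // => y _; rewrite exprn_ge0.
rewrite VE; apply: le_trans (sqr_norm_sum_le G) _.
have -> : (6 * n ^ 3 * p ^ 2 = n * n * (n * (6 * p ^ 2)))%N by ring.
by rewrite card_prod card_ord [leRHS]natrM ler_wpM2l.
Qed.

Lemma norm_expsum_shifted_reciprocal_le (a b : 'F_p) : a != 0 ->
  `|expsum w (shifted_reciprocal b) a| ^+ 4 <= (6 * n ^ 5 * p ^ 2)%:R.
Proof.
move=> a_neq0.
have -> : expsum w (shifted_reciprocal b) a
    = \sum_(j < n) reciprocal_segment_sum a (b + j%:R).
  by rewrite /reciprocal_segment_sum pair_bigA.
have sqr_norm_le : `|\sum_(j < n) reciprocal_segment_sum a (b + j%:R)| ^+ 2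
    <= n%:R * \sum_y `|reciprocal_segment_sum a y| ^+ 2.
  apply: le_trans (sqr_norm_sum_le _) _; rewrite card_ord ler_wpM2l //.
  apply: (ler_sum_inj (h := fun j : 'I_n => b + j%:R)
    (F := fun y => `|reciprocal_segment_sum a y| ^+ 2)) => [i j /addrI | y].
    exact: natr_ord_Fp_inj.
  by rewrite exprn_ge0.
have -> : (6 * n ^ 5 * p ^ 2 = n ^ 2 * (6 * n ^ 3 * p ^ 2))%N by ring.
rewrite (exprM _ 2 2) natrM natrX.
apply: le_trans
  (_ : (n%:R * \sum_y `|reciprocal_segment_sum a y| ^+ 2) ^+ 2 <= _).
  by rewrite lerXn2r ?nnegrE ?(le_trans _ sqr_norm_le) ?exprn_ge0.
rewrite exprMn ler_wpM2l ?exprn_ge0 //.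
exact: sum_sqr_norm_reciprocal_segment_sum_le.
Qed.

Lemma card_shifted_reciprocal_eq (b : 'F_p) :
  (#|[set st : ('I_n * 'I_n) * ('I_n * 'I_n)
       | shifted_reciprocal b st.1 == shifted_reciprocal b st.2]| <= n ^ 3)%N.
Proof.
pose h (st : ('I_n * 'I_n) * ('I_n * 'I_n)) := (st.1, st.2.1).
have -> : (n ^ 3 = #|{: ('I_n * 'I_n) * 'I_n}|)%N.
  by rewrite !card_prod !card_ord; ring.
rewrite -(@card_in_imset _ _ h) ?max_card //.
move=> [[j d] [j' d']] [[k e] [k' e']]; rewrite !inE /shifted_reciprocal /=.
move=> /eqP/invr_inj eq_s /eqP/invr_inj eq_t [kj ed kj'].
move: eq_s; rewrite kj ed kj' eq_t => /addrI/(natr_ord_Fp_inj p_pr n_le).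
by move=> ->.
Qed.

Lemma sum_norm_expsum_shifted_reciprocal_le (m : nat) (b : 'F_p) :
  \sum_(a | a != 0) `|expsum w (shifted_reciprocal b) a| ^+ (m + 6)
    <= (6 * p ^ 3 * (n ^ 8 * (n * n) ^ m))%:R.
Proof.
pose S := expsum w (shifted_reciprocal b).
apply: le_trans
  (_ : \sum_a (6 * n ^ 5 * p ^ 2 * (n * n) ^ m)%:R * `|S a| ^+ 2 <= _).
  rewrite big_mkcond; apply: ler_sum => a _; case: eqP => [_|/eqP a_neq0] /=.
    by rewrite mulr_ge0 ?exprn_ge0.
  rewrite (exprD _ m 6) (exprD _ 4 2) mulrA ler_wpM2r ?exprn_ge0 //.
  rewrite mulrC natrM natrX ler_pM ?exprn_ge0 //.
    exact: norm_expsum_shifted_reciprocal_le.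
  rewrite lerXn2r ?nnegrE // (le_trans (norm_expsum_le p_pr w_prim _ _)) //.
  by rewrite card_prod card_ord.
rewrite -mulr_sumr sum_sqr_norm_expsum // -natrM ler_nat.
have -> : (6 * p ^ 3 * (n ^ 8 * (n * n) ^ m)
    = 6 * n ^ 5 * p ^ 2 * (n * n) ^ m * (p * n ^ 3))%N by ring.
by rewrite leq_mul2l leq_mul2l card_shifted_reciprocal_eq !orbT.
Qed.

End ReciprocalSums.

(** * A fixed numerator *)

Lemma shifted_reciprocal_cover (p n m : nat) (b : 'F_p) :
  prime p -> (n <= p)%N -> (6 * p ^ 3 < n ^ 4)%N ->
  forall l : 'F_p, exists t : 'I_(m + 6) -> 'I_n * 'I_n,
    \sum_i shifted_reciprocal b (t i) = l.
Proof.
move=> p_pr n_le n_gt; have [w w_prim] := C_prim_root_exists (prime_gt0 p_pr).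
have n_gt0 : (0 < n)%N by case: (n) n_gt.
apply: (expsum_cover p_pr w_prim).
apply: le_lt_trans
  (sum_norm_expsum_shifted_reciprocal_le p_pr w_prim n_le m b) _.
rewrite card_prod card_ord -natrX ltr_nat.
have -> : ((n * n) ^ (m + 6) = n ^ 4 * (n ^ 8 * (n * n) ^ m))%N.
  by rewrite expnD; ring.
by rewrite ltn_pmul2r // !(muln_gt0, expn_gt0) n_gt0.
Qed.

Lemma fraction_sums_cover_large_denominators (p m Y : nat)
    (I : {set 'F_p}) (x0 b : 'F_p) :
  prime p -> x0 \in I -> x0 != 0 ->
  (Y <= p)%N -> (6 * 8 ^ 4 * p ^ 3 < Y ^ 4)%N ->
  fraction_sums_cover (m + 6) I (Fp_segment b Y).
Proof.
move=> p_pr x0I x0_neq0 Y_le Y_gt l; have p_gt0 := prime_gt0 p_pr.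
have Y_ge : (4 <= Y)%N.
  rewrite -(@leq_exp2r _ _ 4) //; apply: leq_trans (ltnW Y_gt).
  by apply: (@leq_trans (6 * 8 ^ 4)) => //; rewrite leq_pmulr // expn_gt0 p_gt0.
pose n := (Y %/ 4)%N.
have n_le : (n * 4 <= Y)%N := leq_divM _ _.
have n_gt : (6 * p ^ 3 < n ^ 4)%N.
  rewrite -(@ltn_pmul2l (8 ^ 4)) // mulnCA mulnA; apply: leq_trans Y_gt _.
  by rewrite -expnMn leq_exp2r // (@leq_double_divn 4).
have [|b' /subsetP b'J b'_neq0] :=
  @exists_Fp_segment_avoiding0 p p_pr b (n + n) Y.
  by rewrite Y_le andbT; lia.
have [|t tE] := shifted_reciprocal_cover m b' p_pr _ n_gt (l / x0).
  by lia.
pose y i := b' + (t i).1%:R + (t i).2%:R.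
have y_in i : y i \in Fp_segment b' (n + n).
  rewrite /y -addrA -natrD mem_Fp_segment //.
  by rewrite -addnS leq_add // ltnW.
exists (fun=> x0), y; split=> // [i|i|].
- exact: b'J.
- by move=> y0; move: (y_in i); rewrite y0 (negPf b'_neq0).
- by rewrite -mulr_sumr tE mulrC divfK.
Qed.

(** * The two ranges of numerators *)

Lemma eventually_natrM_le_powR (R : realType) (eps : R) (L : nat) : 0 < eps ->
  exists p0 : nat, forall p : nat, (p0 < p)%N ->
    (L * p)%:R <= powR (p%:R : R) (1 + eps).
Proof.
move=> eps_gt0; exists (Num.bound (powR (L%:R : R) eps^-1)) => p p_gt.
have p_gt0 : (0 < p)%N by exact: leq_ltn_trans p_gt.
rewrite powRD; last by rewrite pnatr_eq0 -lt0n p_gt0 implybT.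
rewrite powRr1 // natrM mulrC ler_wpM2l //.
have -> : L%:R = powR (powR (L%:R : R) eps^-1) eps.
  by rewrite -powRrM mulVf ?gt_eqF // powRr1.
rewrite ge0_ler_powR ?nnegrE ?powR_ge0 // ?ltW //.
by apply: lt_trans (archi_boundP (powR_ge0 _ _)) _; rewrite ltr_nat.
Qed.

Lemma small_numerators_large_denominators (q K p X Y : nat) :
  (X ^ 8 < K * p)%N -> ((q + K) * p < X ^ 2 * Y)%N -> (q * p ^ 3 < Y ^ 4)%N.
Proof.
move=> X_lt LX2Y; set L := (q + K)%N in LX2Y.
have p_gt0 : (0 < p)%N by case: (p) X_lt; rewrite // muln0.
have K_gt0 : (0 < K)%N by case: (K) X_lt.
have L_gt0 : (0 < L)%N by rewrite addn_gt0 K_gt0 orbT.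
have qK_le : (q * K <= L ^ 4)%N.
  apply: (@leq_trans (L ^ 2)); last by rewrite leq_pexp2l.
  by rewrite leq_mul ?leq_addl ?leq_addr.
have : ((L * p) ^ 4 < K * p * Y ^ 4)%N.
  apply: (@leq_trans ((X ^ 2 * Y) ^ 4)); first by rewrite ltn_exp2r.
  by rewrite expnMn -expnM leq_mul2r (ltnW X_lt) orbT.
have -> : ((L * p) ^ 4 = p * (L ^ 4 * p ^ 3))%N by ring.
have -> : (K * p * Y ^ 4 = p * (K * Y ^ 4))%N by ring.
rewrite ltn_pmul2l // => L4_lt.
rewrite -(ltn_pmul2l K_gt0); apply: leq_ltn_trans L4_lt.
by rewrite mulnA [(K * q)%N]mulnC leq_mul2r qK_le orbT.
Qed.

Theorem theorem1 (R : realType) (eps : R) (heps : 0 < eps) :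
  exists p0 : nat, forall p : nat, prime p -> (p0 < p)%N ->
  forall I J : {set 'F_p},
    nonzero_Fp_interval I -> nonzero_Fp_interval J ->
    powR (p%:R : R) (1 + eps) < (#|I|)%:R ^+ 2 * (#|J|)%:R ->
    powR (p%:R : R) (1 + eps) < (#|I|)%:R * (#|J|)%:R ^+ 2 ->
  forall lambda : 'F_p,
    exists x y : 'I_8 -> 'F_p,
      [/\ forall i, x i \in I,
          forall i, y i \in J,
          forall i, y i <> 0
        & \sum_(i < 8) x i / y i = lambda].
Proof.
have [K cover_large_numerators] := @fraction_sums_cover_large_numerators 7 isT.
have [p0 Lp_le] := eventually_natrM_le_powR (6 * 8 ^ 4 + K) heps.
exists p0 => p p_pr /Lp_le {}Lp_le I J.
move=> [[a [X [/andP[X_gt0 X_le] ->]]] I_neq0] [[b [Y [/andP[_ Y_le] ->]]] _].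
rewrite -/(Fp_segment a X) -/(Fp_segment b Y) in I_neq0 *.
rewrite !card_Fp_segment //.
move=> /(le_lt_trans Lp_le) + /(le_lt_trans Lp_le).
rewrite -!natrX -!natrM !ltr_nat => LX2Y LXY2.
have K_le : (K * p <= (6 * 8 ^ 4 + K) * p)%N by rewrite leq_mul2r leq_addl orbT.
have [KX | X_small] := leqP (K * p) (X ^ 8).
  by apply: cover_large_numerators; rewrite // (leq_trans K_le) // ltnW.
have /subsetPn[x0 x0I] : ~~ (Fp_segment a X \subset [set 0]).
  rewrite subset1 negb_or -card_gt0 card_Fp_segment // X_gt0 andbT.
  exact/eqP.
rewrite inE => x0_neq0.
apply: (@fraction_sums_cover_large_denominators p 2 Y _ x0 b) => //.
exact: small_numerators_large_denominators X_small LX2Y.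
Qed.
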